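(* Let $\Lambda$ be a commutative Noetherian ring in which linear equations are solvable, let $I=\langle \nu_1,\ldots,\nu_s\rangle$ be a proper ideal of $\Lambda$ with $\nu_1,\ldots,\nu_s\in\Lambda$, and let $R=\Lambda/I$, $T=\Lambda[x_1,\ldots,x_n]$, $A=R[x_1,\ldots,x_n]$. Let $\varphi:T\to A$ be the ring epimorphism $\sum_i\lambda_ix^{\alpha(i)}\mapsto\sum_i\overline{\lambda}_ix^{\alpha(i)}$, where $\overline{\lambda}=\lambda+I$, and fix a monomial ordering $\prec$ on the monomials $x^\alpha$. Let $\overline J=\langle \overline f_1,\ldots,\overline f_t\rangle$ be an ideal of $A$, where $\overline f_i=\sum_j\overline{\lambda}_{ij}x^{\alpha(j)}$ are nonzero polynomials written with nonzero coefficients $\overline\lambda_{ij}$ represented by $\lambda_{ij}\in\Lambda$. Put $f_i=\sum_j\lambda_{ij}x^{\alpha(j)}\in T$ (same terms), $S=\{f_1,\ldots,f_t,\nu_1,\ldots,\nu_s\}$, and let $J=\langle S\rangle$ be the ideal of $T$ generated by $S$. Let $\mathcal G=\{g_1,\ldots,g_m\}$ be a Gröbner basis of $J$ with respect to $\prec$ constructed by the Gröbner basis algorithm (recalled in the context) with initial input $S$. Then: (i) For each $g_i\in\mathcal G$ with $g_i\notin\{\nu_1,\ldots,\nu_s\}$ we have $\varphi(g_i)\neq 0$, $\mathbf{LT}(\varphi(g_i))=\varphi(\mathbf{LT}(g_i))$, and hence $\mathbf{LM}(\varphi(g_i))=\mathbf{LM}(g_i)$. (ii) The set $$\overline{\mathcal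 G}=\{\overline g_k=\varphi(g_k)\mid g_k\in\mathcal G,\ g_k\neq\nu_j,\ 1\le j\le s\}=\varphi(\mathcal G)-\{0\}$$ is a Gröbner basis for $\overline J$ with respect to $\prec$. (iii) Each $g_k\in\mathcal G-\{\nu_1,\ldots,\nu_s\}$ has a representation $g_k=g_k'+g_k''$ with $g_k'=\sum_q\mu_{kq}x^{\alpha(q)}$, $\mu_{kq}\notin I$ for all $q$, and $g_k''=\sum_\ell\mu_{k\ell}x^{\alpha(\ell)}$, $\mu_{k\ell}\in I$ for all $\ell$, and such a representation can be algorithmically determined. Hence each element of $\overline{\mathcal G}$ has a representation $\overline g_k=\varphi(g_k)=\varphi(g_k')=\sum_q\overline\mu_{kq}x^{\alpha(q)}$ with all $\overline\mu_{kq}\neq 0$.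
   Context: Definitions for a commutative Noetherian ring $\Lambda$ and $T=\Lambda[x_1,\ldots,x_n]$ (the same definitions are used for $R$ and $A$). Linear equations are solvable in $\Lambda$ if: (1) given $\lambda,\lambda_1,\ldots,\lambda_m\in\Lambda$ there is an algorithm deciding whether $\lambda\in\langle\lambda_1,\ldots,\lambda_m\rangle$ and, if so, computing $\mu_i\in\Lambda$ with $\lambda=\sum\lambda_i\mu_i$; (2) given $\lambda_1,\ldots,\lambda_m\in\Lambda$ there is an algorithm computing a generating set of the $\Lambda$-module $\mathrm{Syz}_\Lambda(\lambda_1,\ldots,\lambda_m)=\{(\mu_1,\ldots,\mu_m)\in\Lambda^m\mid\sum\lambda_i\mu_i=0\}$. Leading data: for $0\ne f=\sum_{i=1}^m\lambda_ix^{\alpha(i)}$ with all $\lambda_i\neq0$ and $x^{\alpha(m)}\prec\cdots\prec x^{\alpha(1)}$, put $\mathbf{LM}(f)=x^{\alpha(1)}$, $\mathbf{LC}(f)=\lambda_1$, $\mathbf{LT}(f)=\lambda_1x^{\alpha(1)}$. Gröbner basis: a finite set $\mathcal G$ of nonzero elements of an ideal $J$ of $T$ is a Gröbner basis of $J$ if $\langle\mathbf{LT}(J)\rangle=\langle\mathbf{LT}(\mathcal G)\rangle$; equivalently, for every $0\neq f\in J$ there are $\lambda_1,\ldots,\lambda_k\in\Lambda-\{0\}$, monomials $x^{\alpha(j)}$ and $g_{i_j}\in\mathcal G$ with $\mathbf{LM}(f)=x^{\alpha(j)}\mathbf{LM}(g_{i_j})$ for all $j$ and $\mathbf{LT}(f)=\sum_j\lambda_jx^{\alpha(j)}\mathbf{LT}(g_{i_j})$.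 Reduction: for a finite set $F$ of nonzero polynomials, $f\ne0$ reduces in one step modulo $F$ to $h=f-\sum_j\lambda_jx^{\alpha(j)}f_{i_j}$ if $f_{i_j}\in F$, $\lambda_j\in\Lambda-\{0\}$, $\mathbf{LM}(f)=x^{\alpha(j)}\mathbf{LM}(f_{i_j})$ for all $j$, and $\mathbf{LT}(f)=\sum_j\lambda_jx^{\alpha(j)}\mathbf{LT}(f_{i_j})$. A nonzero $f$ that admits no such step is minimal with respect to $F$. A chain of such steps is denoted $\to_+$. Gröbner basis algorithm with input a finite set $S$ of nonzero polynomials (zero elements of the input are discarded): start with $G:=\emptyset$, $G':=S$. While $G'\ne G$: set $G:=G'=\{g_1,\ldots,g_k\}$; compute a finite homogeneous generating set $B$ of $\mathrm{Syz}_T(\mathbf{LT}(g_1),\ldots,\mathbf{LT}(g_k))$; for each $(h_1,\ldots,h_k)\in B$ reduce $\sum h_ig_i$ modulo the current $G'$ to some $r$ which is either $0$ or minimal with respect to $G'$, and if $r\neq0$ replace $G'$ by $G'\cup\{r\}$. The output is $G$, a Gröbner basis of $\langle S\rangle$. *)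

(* Defs.v *)
From Stdlib Require Export Relation_Operators.
From HB Require Import structures.
From mathcomp Require Export all_boot all_order all_algebra.
From mathcomp Require Export ring_quotient finmap.
From mathcomp.multinomials Require Export mpoly.

Set Implicit Arguments.
Unset Strict Implicit.
Unset Printing Implicit Defensive.

Import GRing.Theory.
Local Open Scope fset_scope.
Local Open Scope ring_scope.
Local Open Scope quotient_scope.

Section Ideals.
Variable R : comNzRingType.
Implicit Types (P : R -> Prop) (l mu : seq R).

Definition ideal_gen P (x : R) : Prop :=
  exists s : seq (R * R),
    (forall p, p \in s -> P p.2) /\ x = \sum_(p <- s) p.1 * p.2.

Definition is_ideal P : Prop :=
  [/\ P 0, forall x y, P x -> P y -> P (x + y) & forall a x, P x -> P (a * x)].

Definition noetherian : Prop :=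
  forall P, is_ideal P ->
    exists l, forall x, P x <-> ideal_gen (fun y => y \in l) x.

Definition syzygy l mu : Prop :=
  size mu = size l /\ \sum_(i < size l) l`_i * mu`_i = 0.

Definition generates_syzygies l (B : seq (seq R)) : Prop :=
  (forall b, b \in B -> syzygy l b) /\
  (forall mu, syzygy l mu ->
     exists c : seq R, forall i, (i < size l)%N ->
       mu`_i = \sum_(j < size B) c`_j * (nth [::] B j)`_i).

(* Solvability of linear equations is data: the two algorithms, together with
   their specifications.  Programs (below) may call both of them. *)
Record linear_solver := LinearSolver {
  ls_member : R -> seq R -> option (seq R);
  ls_syz : seq R -> seq (seq R);
  ls_memberP : forall x l,
    match ls_member x l with
    | Some mu => size mu = size l /\ x = \sum_(i < size l) l`_i * mu`_i
    | None => ~ ideal_gen (fun y => y \in l) x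
    end;
  ls_syzP : forall l, generates_syzygies l (ls_syz l)
}.

End Ideals.

Section GroebnerBases.
Variables (n : nat) (R : comNzRingType).
Notation T := {mpoly R[n]}.
Implicit Types (f g h r : T) (F G : {fset T}).

Definition monomial_ordering (le : rel 'X_{1..n}) : Prop :=
  [/\ total le, antisymmetric le, transitive le,
      forall a, le 0%MM a
    & forall a b c, le a b -> le (c + a)%MM (c + b)%MM].

Variable le : rel 'X_{1..n}.

(* The value of LM at 0 is junk; LC 0 = 0 and LT 0 = 0. *)
Definition LM f : 'X_{1..n} :=
  head 0%MM (sort (fun a b => le b a) (msupp f)).
Definition LC f : R := f@_(LM f).
Definition LT f : T := LC f *: 'X_[LM f].

Definition groebner_basis (J : T -> Prop) G : Prop :=
  (forall g, g \in G -> g != 0 /\ J g) /\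
  (forall p,
     ideal_gen (fun q => exists f, [/\ J f, f != 0 & q = LT f]) p <->
     ideal_gen (fun q => exists g, g \in G /\ q = LT g) p).

(* An entry (c, a, g) of s stands for the summand c x^a g. *)
Definition red_step F f h : Prop :=
  f != 0 /\ exists s : seq (R * 'X_{1..n} * T),
    [/\ forall u, u \in s ->
          [/\ u.1.1 != 0, u.2 \in F & LM f = (u.1.2 + LM u.2)%MM],
        LT f = \sum_(u <- s) u.1.1 *: ('X_[u.1.2] * LT u.2)
      & h = f - \sum_(u <- s) u.1.1 *: ('X_[u.1.2] * u.2)].

Definition minimal F f : Prop := f != 0 /\ ~ exists h, red_step F f h.

Definition reduces F : T -> T -> Prop := clos_refl_trans T (red_step F).

(* (h_1, ..., h_k) is homogeneous of degree x^d: every h_i is zero or a single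
   term c x^b with x^b LM(g_i) = x^d. *)
Definition homogeneous (gs hs : seq T) : Prop :=
  exists d : 'X_{1..n}, forall i, (i < size gs)%N ->
    exists (c : R) (b : 'X_{1..n}),
      hs`_i = c *: 'X_[b] /\ (c != 0 -> (b + LM gs`_i)%MM = d).

Definition comb (gs hs : seq T) : T := \sum_(i < size gs) hs`_i * gs`_i.

(* One execution of the inner loop, over the syzygies B, on the current set. *)
Inductive gb_pass (gs : seq T) : seq (seq T) -> {fset T} -> {fset T} -> Prop :=
| Gb_pass_nil F : gb_pass gs [::] F F
| Gb_pass_zero hs B F F' :
    reduces F (comb gs hs) 0 -> gb_pass gs B F F' ->
    gb_pass gs (hs :: B) F F'
| Gb_pass_add hs B F F' r :
    reduces F (comb gs hs) r -> minimal F r -> gb_pass gs B (r |` F) F' ->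
    gb_pass gs (hs :: B) F F'.

(* gb_loop G G' out: the while loop entered with values G and G' of its two
   variables can end with output out.  The choices left open by the algorithm
   (enumeration of G, the set B and its enumeration, the reductions) are
   nondeterministic. *)
Inductive gb_loop : {fset T} -> {fset T} -> {fset T} -> Prop :=
| Gb_stop G : gb_loop G G G
| Gb_iter G G' G'' out gs B :
    G' <> G ->
    perm_eq gs G' ->
    generates_syzygies [seq LT g | g <- gs] B ->
    (forall hs, hs \in B -> homogeneous gs hs) ->
    gb_pass gs B G' G'' ->
    gb_loop G' G'' out ->
    gb_loop G G' out.

Definition gb_algorithm (S : seq T) (out : {fset T}) : Prop :=
  gb_loop fset0 [fset f in S | f != 0] out.

End GroebnerBases.

Section Reduction.
Variables (n : nat) (R : comNzRingType) (I : idealr R).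

Definition phi : {mpoly R[n]} -> {mpoly {ideal_quot I}[n]} :=
  map_mpoly \pi_{ideal_quot I}.

(* The polynomial with the same monomials as fb and coefficients lam. *)
Definition lift_poly (fb : {mpoly {ideal_quot I}[n]}) (lam : 'X_{1..n} -> R) :
    {mpoly R[n]} :=
  \sum_(m <- msupp fb) lam m *: 'X_[m].

End Reduction.

(* Algorithms over a ring with solvable linear equations are syntactic: closed
   programs built from pairs, options, primitive recursion over naturals and
   lists, the ring operations, and calls to the two linear algebra algorithms.
   A program contains no ring elements and does not depend on the ring. *)
Inductive ty : Set :=
| TUnit | TNat | TCoef
| TProd (a b : ty) | TList (a : ty) | TOpt (a : ty).

Inductive prog : ty -> ty -> Set :=
| PId a : prog a a
| PComp a b c : prog b c -> prog a b -> prog a c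
| PUnit a : prog a TUnit
| PPair c a b : prog c a -> prog c b -> prog c (TProd a b)
| PFst a b : prog (TProd a b) a
| PSnd a b : prog (TProd a b) b
| PZero a : prog a TNat
| PSucc : prog TNat TNat
| PNatRec c a :
    prog c a -> prog (TProd c (TProd TNat a)) a -> prog (TProd c TNat) a
| PNil a b : prog a (TList b)
| PCons a : prog (TProd a (TList a)) (TList a)
| PFold c a b :
    prog c b -> prog (TProd c (TProd a b)) b -> prog (TProd c (TList a)) b
| PNone a b : prog a (TOpt b)
| PSome a : prog a (TOpt a)
| POptCase c a b :
    prog c b -> prog (TProd c a) b -> prog (TProd c (TOpt a)) b
| PRing0 a : prog a TCoef
| PRing1 a : prog a TCoef
| PAdd : prog (TProd TCoef TCoef) TCoef
| POpp : prog TCoef TCoef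
| PMul : prog (TProd TCoef TCoef) TCoef
| PMember : prog (TProd TCoef (TList TCoef)) (TOpt (TList TCoef))
| PSyz : prog (TList TCoef) (TList (TList TCoef)).

Fixpoint den (R : Type) (t : ty) : Type :=
  match t with
  | TUnit => unit
  | TNat => nat
  | TCoef => R
  | TProd a b => (den R a * den R b)%type
  | TList a => seq (den R a)
  | TOpt a => option (den R a)
  end.

Fixpoint run (R : comNzRingType) (LS : linear_solver R) a b (p : prog a b) :
    den R a -> den R b :=
  match p in prog a b return den R a -> den R b with
  | PId _ => fun x => x
  | PComp _ _ _ q p => fun x => run LS q (run LS p x)
  | PUnit _ => fun=> tt
  | PPair _ _ _ p q => fun x => (run LS p x, run LS q x)
  | PFst _ _ => fun x => x.1
  | PSnd _ _ => fun x => x.2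
  | PZero _ => fun=> 0%N
  | PSucc => S
  | PNatRec _ _ p q => fun x =>
      nat_rect _ (run LS p x.1) (fun k y => run LS q (x.1, (k, y))) x.2
  | PNil _ _ => fun=> [::]
  | PCons _ => fun x => x.1 :: x.2
  | PFold _ _ _ p q => fun x =>
      foldr (fun u y => run LS q (x.1, (u, y))) (run LS p x.1) x.2
  | PNone _ _ => fun=> None
  | PSome _ => Some
  | POptCase _ _ _ p q => fun x =>
      if x.2 is Some y then run LS q (x.1, y) else run LS p x.1
  | PRing0 _ => fun=> 0
  | PRing1 _ => fun=> 1
  | PAdd => fun x => x.1 + x.2
  | POpp => fun x => - x
  | PMul => fun x => x.1 * x.2
  | PMember => fun x => ls_member LS x.1 x.2
  | PSyz => ls_syz LS
  end.

(* Polynomials as data for programs: lists of terms (coefficient, exponents). *)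
Definition TPoly : ty := TList (TProd TCoef (TList TNat)).

Definition terms_of (n : nat) (R : comNzRingType) (f : {mpoly R[n]})
    (l : seq (R * seq nat)) : Prop :=
  perm_eq l [seq (f@_m, (m : seq nat)) | m <- msupp f].

(* Main.v *)
(* Every element that the algorithm adds to its current set F is minimal with
   respect to F, and F contains the nonzero constants among nu_1, ..., nu_s.  A
   leading coefficient in I would be a combination of these constants, which
   would give a reduction step; so the leading coefficients of the elements of
   the output other than the nu_j lie outside I and survive in the quotient.
   Conversely, a nonzero element of Jb lifts to an element of J without
   coefficients in I, whose leading term is a combination of leading terms of
   G; applying phi gives the Groebner basis property. *)
Require Import Defs.

Set Implicit Arguments.
Unset Strict Implicit.
Unset Printing Implicit Defensive.

Import GRing.Theory.
Local Open Scope fset_scope.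
Local Open Scope ring_scope.
Local Open Scope quotient_scope.

(** * Generated ideals and their behaviour under ring morphisms *)

Section GeneratedIdeals.
Variable R : comNzRingType.
Implicit Types P Q : R -> Prop.

Lemma ideal_gen_is_ideal P : is_ideal (ideal_gen P).
Proof.
split.
- by exists [::]; split=> //; rewrite big_nil.
- move=> x y [s [Ps ->]] [u [Pu ->]]; exists (s ++ u); split.
    by move=> p; rewrite mem_cat => /orP[/Ps|/Pu].
  by rewrite big_cat.
move=> a x [s [Ps ->]]; exists [seq (a * p.1, p.2) | p <- s]; split.
  by move=> _ /mapP[p /Ps Pp ->].
by rewrite big_map mulr_sumr; apply: eq_bigr => p _ /=; rewrite mulrA.
Qed.

Lemma mem_ideal_gen P x : P x -> ideal_gen P x.
Proof.
move=> Px; exists [:: (1, x)]; split; last by rewrite big_seq1 mul1r.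
by move=> p; rewrite inE => /eqP->.
Qed.

Lemma ideal_gen_sub P Q :
  is_ideal Q -> (forall x, P x -> Q x) -> forall x, ideal_gen P x -> Q x.
Proof.
case=> Q0 QD QM PQ _ [s [Ps ->]].
by rewrite big_seq; apply: big_ind => // p /Ps Pp; apply/QM/PQ.
Qed.

Lemma is_ideal_sum Q (T : eqType) (s : seq T) (F : T -> R) :
  is_ideal Q -> (forall i, i \in s -> Q (F i)) -> Q (\sum_(i <- s) F i).
Proof. by case=> Q0 QD _ QF; rewrite big_seq; apply: big_ind. Qed.

Lemma is_idealN Q x : is_ideal Q -> Q x -> Q (- x).
Proof. by case=> _ _ QM Qx; rewrite -mulN1r; apply: QM. Qed.

End GeneratedIdeals.

Lemma preim_is_ideal (R R' : comNzRingType) (h : {rmorphism R -> R'})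
    (Q : R' -> Prop) :
  is_ideal Q -> is_ideal (fun x => Q (h x)).
Proof.
by case=> Q0 QD QM; split=> [|x y Qx Qy|a x Qx];
  rewrite ?rmorph0 ?rmorphD ?rmorphM; auto.
Qed.

(** Surjectivity gives closure under multiplication: a scalar of [R'] is lifted to [R] and
    multiplied there. *)
Lemma image_is_ideal (R R' : comNzRingType) (h : {rmorphism R -> R'})
    (Q : R -> Prop) :
  (forall y, exists x, h x = y) -> is_ideal Q ->
  is_ideal (fun y => exists2 x, Q x & h x = y).
Proof.
move=> h_surj [Q0 QD QM]; split.
- by exists 0; rewrite ?rmorph0.
- by move=> _ _ [x Qx <-] [y Qy <-]; exists (x + y); rewrite ?rmorphD; auto.
move=> b _ [x Qx <-]; have [a <-] := h_surj b.
by exists (a * x); rewrite ?rmorphM; auto.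
Qed.

(** * Leading monomials, reduction by constants, and invariants of the algorithm *)

Section LeadingMonomials.
Variables (n : nat) (R : comNzRingType) (le : rel 'X_{1..n}).
Hypothesis le_ord : monomial_ordering le.
Implicit Types (f g r : {mpoly R[n]}) (c : R).

Lemma mcoeff_sum_terms (s : seq 'X_{1..n}) (c : 'X_{1..n} -> R) k :
  uniq s -> (\sum_(m <- s) c m *: 'X_[m])@_k = if k \in s then c k else 0.
Proof.
move=> s_uniq; rewrite raddf_sum /=.
under eq_bigr => m _ do rewrite mcoeffZ mcoeffX.
case: ifP => [ks|/negP ks]; last first.
  rewrite big_seq big1 // => m ms.
  by case: eqP => [mk|]; rewrite ?mulr0 //; case: ks; rewrite -mk.
rewrite (bigD1_seq k) //= eqxx mulr1 big1 ?addr0 // => m /negPf->.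
by rewrite mulr0.
Qed.

Lemma LM_msupp f : f != 0 -> LM le f \in msupp f.
Proof.
rewrite -msupp_eq0 /LM -(mem_sort (fun a b => le b a)) -size_eq0.
rewrite -(size_sort (fun a b => le b a)).
by case: (sort _ _) => [|m l] //= _; rewrite mem_head.
Qed.

Lemma le_LM f m : m \in msupp f -> le m (LM le f).
Proof.
have [le_tot _ le_tr _ _] := le_ord.
rewrite /LM -(mem_sort (fun a b => le b a)).
have: sorted (fun a b => le b a) (sort (fun a b => le b a) (msupp f)).
  by apply: sort_sorted => a b; apply: le_tot.
case: (sort _ _) => [|k l] //= path_l.
rewrite inE => /orP[/eqP-> | ml]; first by have /orP[] := le_tot k k.
have ge_tr : transitive (fun a b => le b a) by move=> b a k' ba kb; apply: le_tr kb ba.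
exact: (allP (order_path_min ge_tr path_l)).
Qed.

Lemma LM_unique f k :
  k \in msupp f -> (forall m, m \in msupp f -> le m k) -> LM le f = k.
Proof.
have [_ le_anti _ _ _] := le_ord => kf max_k; apply: le_anti.
by rewrite le_LM // max_k // LM_msupp // -msupp_eq0; case: msupp kf.
Qed.

Lemma LM_mpolyC c : LM le c%:MP_[n] = 0%MM.
Proof.
(* For [c = 0] the default value of [head] in [LM] is already the exponent [0%MM]. *)
have [-> | c0] := eqVneq c 0; first by rewrite /LM msupp0.
apply: LM_unique; first by rewrite msuppC (negPf c0) inE.
by case: le_ord => le_tot _ _ _ _ m; rewrite msuppC (negPf c0) inE => /eqP->;
  have /orP[] := le_tot 0%MM 0%MM.
Qed.

Lemma LT_mpolyC c : LT le c%:MP_[n] = c%:MP.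
Proof. by rewrite /LT /LC LM_mpolyC mcoeffC eqxx mulr1 -mul_mpolyC mpolyX0 mulr1. Qed.

(* A leading coefficient in the ideal of the constants contained in F could be
   cancelled by subtracting multiples of these constants. *)
Lemma minimal_LC_notin (nu : seq R) (F : {fset {mpoly R[n]}}) r :
  (forall x, x \in nu -> x != 0 -> x%:MP \in F) -> minimal le F r ->
  ~ ideal_gen (fun y => y \in nu) (LC le r).
Proof.
move=> nuF [r0 r_min] [s [s_nu LCr]]; apply: r_min.
(* A constant has leading monomial 1, so each summand [p.1 * p.2] of the leading coefficient turns
   into the multiple [p.1] times ['X_[LM le r]] of the constant [p.2]. Summands with a zero factor
   are dropped: a reduction step needs nonzero coefficients, and only nonzero constants are known to
   lie in [F]. *)
pose s' := [seq ((p.1, LM le r), (p.2)%:MP_[n])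
             | p <- s & (p.1 != 0) && (p.2 != 0)].
exists (r - \sum_(u <- s') u.1.1 *: ('X_[u.1.2] * u.2)); split=> //.
exists s'; split=> //.
  move=> u /mapP[p]; rewrite mem_filter => /andP[/andP[p1 p2] ps] -> /=.
  by rewrite p1 LM_mpolyC addm0 nuF //; apply: s_nu.
rewrite big_map big_filter /= [LHS]/LT LCr scaler_suml.
rewrite [RHS]big_mkcond; apply: eq_bigr => p _ /=.
rewrite LT_mpolyC [_ * _%:MP]mulrC mul_mpolyC scalerA.
have [-> | _] := eqVneq p.1 0; first by rewrite !mul0r scale0r.
by have [-> | _] := eqVneq p.2 0; rewrite // mulr0 scale0r.
Qed.

(** Invariant rule: the current set changes only by adding a remainder minimal with respect to it,
    and the output is the last current set. *)
Lemma gb_loop_ind_fset (P : {fset {mpoly R[n]}} -> Prop) F F' out :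
  (forall H r, P H -> minimal le H r -> P (r |` H)) ->
  P F' -> gb_loop le F F' out -> P out.
Proof.
move=> P_add PF' loop; elim: loop PF' => // {F F' out}.
move=> F F' F'' out gs B _ _ _ _ pass _ IH PF'; apply: IH.
elim: pass PF' => // {F F' F'' out gs B} _ B F F' r _ r_min _ IH PF.
exact/IH/P_add.
Qed.

End LeadingMonomials.

(** * The map to the quotient and the splitting of a polynomial by its coefficients *)

Section Quotient.
Variables (n : nat) (R : comNzRingType) (I : idealr R) (le : rel 'X_{1..n}).
Hypothesis le_ord : monomial_ordering le.
Implicit Types (f g : {mpoly R[n]}) (x : R).
Local Notation Q := {ideal_quot I}.
Local Notation phi := (@phi n R I).

Lemma pi_eq0 x : (\pi_Q x == 0) = (x \in I).
Proof. by rewrite -[x in RHS]subr0 Quotient.idealrBE raddf0. Qed.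

Lemma mcoeff_phi f m : (phi f)@_m = \pi_Q f@_m.
Proof. exact: mcoeff_map_mpoly. Qed.

Lemma phi0 : phi 0 = 0.
Proof. exact: raddf0. Qed.

Lemma phi_term x m : phi (x *: 'X_[m]) = \pi_Q x *: 'X_[m].
Proof. by rewrite /phi map_mpolyZ map_mpolyX. Qed.

Lemma phiE f : phi f = \sum_(m <- msupp f) \pi_Q f@_m *: 'X_[m].
Proof.
rewrite {1}(mpolyE f) /phi raddf_sum.
by apply: eq_bigr => m _; apply: phi_term.
Qed.

Lemma phi_lift_poly (fb : {mpoly Q[n]}) (lam : 'X_{1..n} -> R) :
  (forall m, m \in msupp fb -> \pi_Q (lam m) = fb@_m) ->
  phi (lift_poly fb lam) = fb.
Proof.
move=> lamP; apply/mpolyP => m; rewrite mcoeff_phi mcoeff_sum_terms ?msupp_uniq //.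
by case: ifP => [/lamP // | /negbT]; rewrite -mcoeff_eq0 raddf0 => /eqP.
Qed.

Lemma phi_surj (h : {mpoly Q[n]}) : exists f, phi f = h.
Proof.
exists (lift_poly h (fun m => repr h@_m)).
by apply: phi_lift_poly => m _; rewrite reprK.
Qed.

(** Applying [phi] can only shrink the support, so a leading monomial whose coefficient survives
    remains the largest one. *)
Lemma phi_leading f :
  LC le f \notin I ->
  [/\ phi f != 0, LT le (phi f) = phi (LT le f) & LM le (phi f) = LM le f].
Proof.
move=> LCf; have LMphi : LM le f \in msupp (phi f).
  by rewrite mcoeff_msupp mcoeff_phi pi_eq0.
have LM_eq : LM le (phi f) = LM le f.
  apply: LM_unique => // m; rewrite mcoeff_msupp mcoeff_phi => fm.
  apply: le_LM => //; rewrite mcoeff_msupp; apply: contraNneq fm => ->.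
  by rewrite raddf0.
split=> //; first by rewrite -msupp_eq0; case: msupp LMphi.
by rewrite /LT /LC LM_eq mcoeff_phi phi_term.
Qed.

(** With [P] membership in [I] or its complement, this is g'' or g' of (iii). The complement also
    provides the lifts used for (ii). *)
Definition coef_part (P : pred R) f : {mpoly R[n]} :=
  \sum_(m <- msupp f | P f@_m) f@_m *: 'X_[m].

Lemma mcoeff_coef_part P f m :
  (coef_part P f)@_m = if P f@_m then f@_m else 0.
Proof.
rewrite /coef_part -big_filter mcoeff_sum_terms ?filter_uniq ?msupp_uniq //.
rewrite mem_filter; case: (P _) => //=.
by case: ifP => // /negbT; rewrite -mcoeff_eq0 => /eqP.
Qed.

Lemma msupp_coef_part P f m :
  (m \in msupp (coef_part P f)) = P f@_m && (m \in msupp f).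
Proof. by rewrite !mcoeff_msupp mcoeff_coef_part; case: ifP; rewrite ?eqxx. Qed.

Lemma coef_partP P f m : m \in msupp (coef_part P f) -> P (coef_part P f)@_m.
Proof. by rewrite msupp_coef_part mcoeff_coef_part => /andP[Pm _]; rewrite Pm. Qed.

Lemma coef_partD P f : f = coef_part (predC P) f + coef_part P f.
Proof.
apply/mpolyP => m; rewrite mcoeffD !mcoeff_coef_part /=.
by case: (P _); rewrite ?add0r ?addr0.
Qed.

Lemma phi_coef_part f : phi (coef_part [predC I] f) = phi f.
Proof.
apply/mpolyP => m; rewrite [RHS]mcoeff_phi [LHS]mcoeff_phi mcoeff_coef_part /=.
by case: ifPn => // /negPn; rewrite -pi_eq0 raddf0 => /eqP.
Qed.

(** The kept terms retain their coefficients and the order of a term list is immaterial, so a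
    program can compute [coef_part] by filtering. *)
Lemma terms_of_coef_part P f (l : seq (R * seq nat)) :
  terms_of f l -> terms_of (coef_part P f) [seq u <- l | P u.1].
Proof.
rewrite /terms_of => /(perm_filter (fun u => P u.1)) /perm_trans; apply.
rewrite filter_map.
rewrite (_ : [seq _ | m <- msupp (coef_part P f)] =
             [seq (f@_m, (m : seq nat)) | m <- msupp (coef_part P f)]).
  apply: perm_map; apply: uniq_perm; rewrite ?filter_uniq ?msupp_uniq //.
  by move=> m; rewrite mem_filter msupp_coef_part.
apply/eq_in_map => m; rewrite msupp_coef_part mcoeff_coef_part.
by case/andP=> ->.
Qed.

End Quotient.

(** * The splitting program and the proof of the three claims *)

(** A right fold over the terms, with the list of the nu_j as environment. When [PMember] answers
    [None] the term joins the first list; otherwise [PFst] discards the certificate and the term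
    joins the second. *)
Definition split_prog : prog (TProd (TList TCoef) TPoly) (TProd TPoly TPoly) :=
  let c := TList TCoef in
  let term := TProd TCoef (TList TNat) in
  let acc := TProd TPoly TPoly in
  let head := PComp (PFst term acc) (PSnd c (TProd term acc)) in
  let res := PComp (PSnd term acc) (PSnd c (TProd term acc)) in
  let res1 := PComp (PFst TPoly TPoly) res in
  let res2 := PComp (PSnd TPoly TPoly) res in
  PFold (PPair (PNil c term) (PNil c term))
    (PComp
       (POptCase
          (PPair (PComp (PCons term) (PPair head res1)) res2)
          (PComp (PPair res1 (PComp (PCons term) (PPair head res2)))
             (PFst (TProd c (TProd term acc)) (TList TCoef))))
       (PPair (PId (TProd c (TProd term acc)))
          (PComp PMember
             (PPair (PComp (PFst TCoef (TList TNat)) head)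
                (PFst c (TProd term acc)))))).

Lemma run_split_prog (R : comNzRingType) (LS : linear_solver R) (nu : seq R)
    (l : seq (R * seq nat)) :
  run LS split_prog (nu, l) =
    ([seq u <- l | ~~ ls_member LS u.1 nu], [seq u <- l | ls_member LS u.1 nu]).
Proof. by elim: l => //= u l ->; case: (ls_member LS u.1 nu). Qed.

(** An answer [Some mu] certifies membership by an explicit combination, and the specification of
    [None] excludes it. *)
Lemma ls_memberE (R : comNzRingType) (LS : linear_solver R) (nu : seq R) x :
  ls_member LS x nu <-> ideal_gen (fun y => y \in nu) x.
Proof.
have := ls_memberP LS x nu; case: (ls_member LS x nu) => [mu [_ ->] | ] //.
split=> // _; have [_ _ genM] := ideal_gen_is_ideal (fun y => y \in nu).
apply: is_ideal_sum => [|i _]; first exact: ideal_gen_is_ideal.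
by rewrite mulrC; apply/genM/mem_ideal_gen/mem_nth.
Qed.

(* split is the algorithm of (iii): on the list nu_1, ..., nu_s and the terms of
   g it returns the terms of g' and of g''. *)
Theorem theorem2p3 :
  exists split : prog (TProd (TList TCoef) TPoly) (TProd TPoly TPoly),
  forall (L : comNzRingType) (noethL : noetherian L) (LS : linear_solver L)
    (s : nat) (nu : s.-tuple L) (I : idealr L)
    (I_gen : forall x : L, x \in I <-> ideal_gen (fun y => y \in nu) x)
    (n : nat) (le : rel 'X_{1..n}) (le_ord : monomial_ordering le)
    (t : nat) (fb : 'I_t -> {mpoly {ideal_quot I}[n]})
    (fb_neq0 : forall i, fb i != 0)
    (lam : 'I_t -> 'X_{1..n} -> L)
    (lamP : forall i m, m \in msupp (fb i) ->
       \pi_{ideal_quot I} (lam i m) = (fb i)@_m),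
  let nuT : seq {mpoly L[n]} := [seq x%:MP | x <- nu] in
  let f i := lift_poly (fb i) (lam i) in
  let S := codom f ++ nuT in
  let J := ideal_gen (fun h => h \in S) in
  let Jb := ideal_gen (fun h => h \in codom fb) in
  forall (G : {fset {mpoly L[n]}})
    (G_alg : gb_algorithm le S G) (G_gb : groebner_basis le J G),
  let Gb := [fset phi I g | g in G & g \notin nuT] in
  [/\ (* (i) *)
      forall g, g \in G -> g \notin nuT ->
        [/\ phi I g != 0, LT le (phi I g) = phi I (LT le g)
          & LM le (phi I g) = LM le g],
      (* (ii) *)
      Gb = (phi I @` G) `\ 0 /\ groebner_basis le Jb Gb
    & (* (iii) *)
      forall g, g \in G -> g \notin nuT ->
        exists g' g'' : {mpoly L[n]},
          [/\ g = g' + g'',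
              (forall m, m \in msupp g' -> g'@_m \notin I)
              /\ (forall m, m \in msupp g'' -> g''@_m \in I),
              forall l, terms_of g l ->
                let o := run LS split (tval nu, l) in
                terms_of g' o.1 /\ terms_of g'' o.2,
              phi I g = phi I g' /\
              phi I g' =
                \sum_(m <- msupp g') \pi_{ideal_quot I} (g'@_m) *: 'X_[m]
            & forall m, m \in msupp g' -> \pi_{ideal_quot I} (g'@_m) != 0]].
Proof.
exists split_prog => L _ LS s nu I I_gen n le le_ord t fb fb_neq0 lam lamP.
move=> nuT f S J Jb G G_alg G_gb Gb.
have J_ideal : is_ideal J := ideal_gen_is_ideal _.
have Jb_ideal : is_ideal Jb := ideal_gen_is_ideal _.
have phi_f i : phi I (f i) = fb i by apply: phi_lift_poly; apply: lamP.
have phi_nu x : x \in nu -> phi I x%:MP_[n] = 0.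
  move=> xnu; have : x \in I by apply/I_gen/mem_ideal_gen.
  by rewrite -pi_eq0 => /eqP pix0; rewrite /phi map_mpolyC /= pix0 mpolyC0.
(* The support of [f i] lies in that of [fb i], so its leading coefficient reduces to a nonzero
   coefficient of [fb i]. *)
have S_LC h : h \in S -> h \notin nuT -> LC le h \notin I.
  rewrite mem_cat => /orP[/codomP[i ->] _ | ->] //.
  have fi0 : f i != 0.
    by apply: contraNneq (fb_neq0 i) => fi0; rewrite -phi_f fi0 phi0.
  have := LM_msupp le fi0; rewrite mcoeff_msupp /LC mcoeff_sum_terms ?msupp_uniq //.
  case: ifP => [mfb _|]; last by rewrite eqxx.
  by rewrite -pi_eq0 lamP // -mcoeff_msupp.
have G_LC g : g \in G -> g \notin nuT -> LC le g \notin I.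
  (* The first conjunct is kept in the invariant because it makes each new minimal remainder satisfy
     the second. *)
  pose P (F : {fset {mpoly L[n]}}) :=
    (forall x, x \in nu -> x != 0 -> x%:MP \in F) /\
    (forall h, h \in F -> h \notin nuT -> LC le h \notin I).
  suff: P G by case=> _; apply.
  apply: gb_loop_ind_fset G_alg => [F r [nuF F_LC] r_min | ].
    split=> [x xnu x0 | h]; first by rewrite in_fsetU nuF ?orbT.
    rewrite in_fset1U => /orP[/eqP-> _ | /F_LC //].
    by apply/negP => /I_gen; apply: minimal_LC_notin r_min.
  split=> [x xnu x0 | h]; last by rewrite !inE => /andP[/S_LC].
  by rewrite !inE mpolyC_eq0 x0 mem_cat map_f ?orbT.
have main_i g : g \in G -> g \notin nuT ->
    [/\ phi I g != 0, LT le (phi I g) = phi I (LT le g)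
      & LM le (phi I g) = LM le g].
  by move=> gG gnu; apply: phi_leading => //; apply: G_LC.
(* Together with [lift_J] this shows that [phi] maps [J] onto [Jb]: it sends [f i] to [fb i] and
   kills the nu_j. *)
have phi_J h : J h -> Jb (phi I h).
  move: h; apply: (@ideal_gen_sub _ _ (fun h => Jb (phi I h))).
    exact: (preim_is_ideal (phi I) Jb_ideal).
  move=> h; rewrite mem_cat => /orP[/codomP[i ->] | /mapP[x xnu ->]].
    by rewrite phi_f; apply/mem_ideal_gen/codom_f.
  by rewrite phi_nu //; case: Jb_ideal.
have lift_J h : Jb h -> exists2 h', J h' & phi I h' = h.
  move: h; apply: (ideal_gen_sub (image_is_ideal (phi_surj (I := I)) J_ideal)).
  move=> _ /codomP[i ->]; exists (f i); last exact: phi_f.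
  by apply: mem_ideal_gen; rewrite mem_cat codom_f.
have J_I x : x \in I -> J x%:MP_[n].
  move=> /I_gen; apply: (@ideal_gen_sub _ _ (fun x => J x%:MP_[n])) => [|y ynu].
    exact: (preim_is_ideal (@mpolyC n L) J_ideal).
  by apply: mem_ideal_gen; rewrite mem_cat map_f ?orbT.
(* Take any lift in [J] and delete its terms with coefficients in [I]. These are multiples of
   constants in [J], so the rest stays in [J] and has the same image. *)
have lift_J_LC h : Jb h -> h != 0 ->
    exists h', [/\ J h', phi I h' = h, h' != 0 & LC le h' \notin I].
  move=> /lift_J[h' Jh' <-] h0; exists (coef_part [predC I] h').
  have part0 : coef_part [predC I] h' != 0.
    by apply: contraNneq h0 => part0; rewrite -(phi_coef_part I h') part0 phi0.
  split; [ | exact: phi_coef_part | exact: part0 |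
    exact: (coef_partP (LM_msupp le part0))].
  have -> : coef_part [predC I] h' = h' - coef_part (mem I) h'.
    by rewrite [X in X - _](coef_partD (mem I) h') addrK.
  have [_ JD JM] := J_ideal; apply: JD Jh' (is_idealN J_ideal _).
  rewrite /coef_part -big_filter; apply: (is_ideal_sum J_ideal) => m.
  rewrite mem_filter => /andP[mI _].
  by rewrite -mul_mpolyC mulrC; apply/JM/J_I.
have [G_J G_LT] := G_gb.
have memGb h : reflect (exists g, [/\ g \in G, g \notin nuT & h = phi I g]) (h \in Gb).
  rewrite /Gb; apply: (iffP (imfsetP _ _ _ _)) => [[g /=] | [g [gG gnu ->]]].
    by rewrite !inE => /andP[gG gnu ->]; exists g.
  by exists g => //=; rewrite !inE gG.
split=> //; first split.
- apply/fsetP => h; apply/memGb/idP => [[g [gG gnu ->]] | ].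
    have [phi_g _ _] := main_i g gG gnu.
    by rewrite in_fsetD1 phi_g; apply: in_imfset.
  rewrite in_fsetD1 => /andP[h0 /imfsetP[g /= gG hE]]; exists g; split=> //.
  (* A nonzero image cannot come from one of the nu_j. *)
  by apply: contraNN h0 => /mapP[x xnu gE]; rewrite hE gE phi_nu.
- split=> [h /memGb[g [gG gnu ->]] | p].
    by have [-> _ _] := main_i g gG gnu; split=> //; apply/phi_J; case: (G_J g gG).
  split; move: p; apply: ideal_gen_sub; try exact: ideal_gen_is_ideal; last first.
    move=> _ [_ [/memGb[g [gG gnu ->]] ->]]; apply: mem_ideal_gen.
    exists (phi I g); have [-> _ _] := main_i g gG gnu.
    by split=> //; apply/phi_J; case: (G_J g gG).
  move=> _ [h [Jbh h0 ->]].
  (* For such a lift, the leading term of [h] is the image of the leading term of [h'], to which the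
     Groebner basis property of [G] applies. *)
  have [h' [Jh' <- h'0 LCh']] := lift_J_LC h Jbh h0.
  have [_ -> _] := phi_leading le_ord LCh'.
  have /G_LT : ideal_gen (fun q => exists f, [/\ J f, f != 0 & q = LT le f]) (LT le h').
    by apply: mem_ideal_gen; exists h'.
  (* The polynomials that [phi] sends into the ideal of leading terms of [Gb] form an ideal, so only
     the generators [LT le g] with [g] in [G] have to be checked. *)
  move: (LT le h'); apply: ideal_gen_sub => [|_ [g [gG ->]]].
    by apply: preim_is_ideal; apply: ideal_gen_is_ideal.
  have [/mapP[x xnu ->] | gnu] := boolP (g \in nuT).
    rewrite LT_mpolyC // phi_nu //.
    by case: (ideal_gen_is_ideal (fun q => exists g, g \in Gb /\ q = LT le g)).
  have [_ <- _] := main_i g gG gnu; apply: mem_ideal_gen.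
  by exists (phi I g); split=> //; apply/memGb; exists g.
move=> g gG gnu; exists (coef_part [predC I] g), (coef_part (mem I) g).
(* The membership test run by the program decides membership in [I], so its filters are those of
   [coef_part]. *)
have mem_I x : (x \in I) = ls_member LS x nu :> bool.
  by apply/idP/idP => [/I_gen/ls_memberE | /ls_memberE/I_gen].
split.
- exact: coef_partD.
- by split=> m /coef_partP.
- move=> l gl; rewrite run_split_prog /=; split.
    rewrite (eq_filter (a2 := fun u => [predC I] u.1)); first exact: terms_of_coef_part.
    by move=> u /=; rewrite -mem_I.
  rewrite (eq_filter (a2 := fun u => (mem I) u.1)); first exact: terms_of_coef_part.
  by move=> u /=; rewrite -mem_I.
- by split; [exact/esym/phi_coef_part | exact: phiE].
- by move=> m /coef_partP; rewrite pi_eq0.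
Qed.
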